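(* The Magnus-type Euler method is A-stable in the mean square for the noncommutative test SDE $$d\boldsymbol{y}(t)=F_{0}\boldsymbol{y}(t)\,dt+F_{1}\boldsymbol{y}(t)\,dW_{1}(t)+F_{2}\boldsymbol{y}(t)\,dW_{2}(t),\quad \boldsymbol{y}(0)=\boldsymbol{y}_{0},$$ with $$F_{0}=\begin{bmatrix}\lambda&0\\0&\lambda\end{bmatrix},\quad F_{1}=\begin{bmatrix}\sigma_{1}&0\\0&-\sigma_{1}\end{bmatrix},\quad F_{2}=\begin{bmatrix}0&\sigma_{2}\\\sigma_{2}&0\end{bmatrix}.$$ That is: for all nonzero real $\lambda,\sigma_{1},\sigma_{2}$ with $2\lambda+\sigma_{1}^{2}+\sigma_{2}^{2}<0$, every step size $h>0$, and every initial value $\boldsymbol{y}_{0}$ with $E[\boldsymbol{y}_{0}^{\top}\boldsymbol{y}_{0}]<\infty$, the numerical solution $\boldsymbol{y}_{n}$ produced by the Magnus-type Euler method with step size $h$ applied to this SDE satisfies $E[\boldsymbol{y}_{n}^{\top}\boldsymbol{y}_{n}]\to0$ as $n\to\infty$.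
   Context: $W_{1},W_{2}$ are independent standard Wiener processes on a filtered probability space with filtration $(\mathcal{F}_t)_{t\ge0}$ (so that increments after time $t$ are independent of $\mathcal{F}_t$), and the $\mathbb{R}^{2}$-valued initial value $\boldsymbol{y}_{0}$ is independent of the Wiener increments $W_j(t)-W_j(0)$. Let $t_{n}=nh$ and $\Delta W_{j}(t_n,t_{n+1})=W_{j}(t_{n+1})-W_{j}(t_{n})$. Magnus-type Euler method: for the linear SDE $d\boldsymbol{y}=F_{0}\boldsymbol{y}\,dt+\sum_{j=1}^{2}F_{j}\boldsymbol{y}\,dW_{j}$ it reads $$\boldsymbol{y}_{n+1}=\exp\big(\Omega^{[1]}(t_{n},t_{n+1})\big)\boldsymbol{y}_{n},\qquad \Omega^{[1]}(t_{n},t_{n+1})=\Big(F_{0}-\tfrac12\sum_{j=1}^{2}F_{j}^{2}\Big)h+\sum_{j=1}^{2}F_{j}\,\Delta W_{j}(t_{n},t_{n+1}),$$ where $\exp$ is the matrix exponential. Definition (A-stability): a numerical method is A-stable in the mean square for the test SDE above if $E[\boldsymbol{y}_{n}^{\top}\boldsymbol{y}_{n}]\to0$ as $n\to\infty$ for any step size $h$ whenever the nonzero parameters $\lambda,\sigma_{1},\sigma_{2}$ satisfy $2\lambda+\sigma_{1}^{2}+\sigma_{2}^{2}<0$ and $E[\boldsymbol{y}_{0}^{\top}\boldsymbol{y}_{0}]<\infty$, where $\boldsymbol{y}_n$ is the numerical solution given by the method. *)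

(* Defs.v *)
From HB Require Import structures.
From mathcomp Require Import all_boot all_order all_algebra.
From mathcomp Require Import all_classical all_reals all_analysis.

Set Implicit Arguments.
Unset Strict Implicit.
Unset Printing Implicit Defensive.

Import Order.TTheory GRing.Theory Num.Theory.
Import numFieldNormedType.Exports.

Local Open Scope classical_set_scope.
Local Open Scope ring_scope.

Definition expmx (R : realType) (k : nat) (A : 'M[R]_k.+1) : 'M[R]_k.+1 :=
  limn (series (fun i : nat => (i`!%:R)^-1 *: A ^+ i)).

Section probability.
Context (R : realType) (d : measure_display) (T : measurableType d).
Variable P : probability T R.

Definition sigma_of (I : Type) (D : set I) (X : I -> T -> R) : set_system T :=
  <<s \bigcup_(i in D) preimage_set_system setT (X i) measurable >>.

Definition independent_systems (G H : set_system T) : Prop :=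
  forall A B, G A -> H B -> (P (A `&` B) = P A * P B)%E.

Definition filtration (F : R -> set_system T) : Prop :=
  [/\ forall t, 0 <= t -> sigma_algebra setT (F t),
      forall t, 0 <= t -> F t `<=` measurable &
      forall s t, 0 <= s -> s <= t -> F s `<=` F t].

(* A process is a function of a real time of which only the restriction to
   nonnegative times matters. The second parameter of [normal_prob] is the
   standard deviation, so that [W t - W s] has variance [t - s]. *)
Record standard_wiener (F : R -> set_system T) (W : R -> T -> R) : Prop := {
  wiener_adapted : forall t, 0 <= t ->
    preimage_set_system setT (W t) measurable `<=` F t ;
  wiener_start : {ae P, forall w, W 0 w = 0} ;
  wiener_increment_law : forall s t, 0 <= s -> s < t ->
    forall B : set R, measurable B ->
      pushforward P (W t \- W s) B = normal_prob 0 (Num.sqrt (t - s)) B ;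
  wiener_increment_indep : forall s t, 0 <= s -> s < t ->
    independent_systems (F s)
      (preimage_set_system setT (W t \- W s) measurable) ;
  wiener_continuous : {ae P, forall w,
    {within `[0, +oo[, continuous (fun t => W t w)}} }.

Definition standard_wiener_pair (F : R -> set_system T)
    (W : 'I_2 -> R -> T -> R) : Prop :=
  [/\ filtration F,
      forall j, standard_wiener F (W j) &
      independent_systems (sigma_of `[0, +oo[ (W 0))
                          (sigma_of `[0, +oo[ (W 1))].

Definition random_vector (k : nat) (y : T -> 'cV[R]_k) : Prop :=
  forall i, measurable_fun setT (fun w => y w i 0).

Definition independent_of_increments (k m : nat) (W : 'I_m -> R -> T -> R)
    (y : T -> 'cV[R]_k) : Prop :=
  independent_systems
    (sigma_of setT (fun (i : 'I_k) w => y w i 0))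
    (sigma_of [set p : 'I_m * R | 0 <= p.2]
       (fun p => W p.1 p.2 \- W p.1 0)).

Definition mean_square (k : nat) (y : T -> 'cV[R]_k) : \bar R :=
  ('E_P[fun w => (((y w)^T *m y w) 0 0)%R])%E.

End probability.

Section magnus_euler.
Context (R : realType) (T : Type).

Definition magnus_exponent (k m : nat) (F0 : 'M[R]_k.+1)
    (F : 'I_m -> 'M[R]_k.+1) (h : R) (dW : 'I_m -> R) : 'M[R]_k.+1 :=
  h *: (F0 - 2^-1 *: \sum_(j < m) F j ^+ 2) + \sum_(j < m) dW j *: F j.

Fixpoint magnus_euler (k m : nat) (F0 : 'M[R]_k.+1)
    (F : 'I_m -> 'M[R]_k.+1) (W : 'I_m -> R -> T -> R) (h : R)
    (y0 : T -> 'cV[R]_k.+1) (n : nat) (w : T) : 'cV[R]_k.+1 :=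
  if n is n'.+1 then
    expmx (magnus_exponent F0 F h
             (fun j => W j (n'.+1%:R * h) w - W j (n'%:R * h) w))
      *m magnus_euler F0 F W h y0 n' w
  else y0 w.

(* A method takes the coefficients and the driving noises of a linear SDE, the
   step size and the initial value to the sequence of numerical solutions. *)
Definition numerical_method (k m : nat) : Type :=
  'M[R]_k -> ('I_m -> 'M[R]_k) -> ('I_m -> R -> T -> R) -> R ->
  (T -> 'cV[R]_k) -> nat -> T -> 'cV[R]_k.

End magnus_euler.

Definition mx22 (R : realType) (a b c e : R) : 'M[R]_2 :=
  \matrix_(i < 2, j < 2)
    if i == 0 then (if j == 0 then a else b) else (if j == 0 then c else e).

Definition test_drift (R : realType) (lambda : R) : 'M[R]_2 :=
  mx22 lambda 0
       0 lambda.

Definition test_diffusion (R : realType) (sigma1 sigma2 : R) (j : 'I_2) :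
    'M[R]_2 :=
  if j == 0 then mx22 sigma1 0
                      0 (- sigma1)
            else mx22 0 sigma2
                      sigma2 0.

Definition mean_square_A_stable (R : realType) (d : measure_display)
    (T : measurableType d) (P : probability T R) (W : 'I_2 -> R -> T -> R)
    (method : numerical_method R T 2 2) : Prop :=
  forall lambda sigma1 sigma2 : R,
  lambda != 0 -> sigma1 != 0 -> sigma2 != 0 ->
  2 * lambda + sigma1 ^+ 2 + sigma2 ^+ 2 < 0 ->
  forall h : R, 0 < h ->
  forall y0 : T -> 'cV[R]_2,
  random_vector y0 -> independent_of_increments P W y0 ->
  (mean_square P y0 < +oo)%E ->
  mean_square P (method (test_drift lambda) (test_diffusion sigma1 sigma2)
                   W h y0 n) @[n --> \oo] --> 0%E.

(* Main.v *)
(** Write [S = F_1 DW_1 + F_2 DW_2 = symm_mx a b] with [a = sigma1 DW_1] and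
    [b = sigma2 DW_2]. It is traceless symmetric with [S ^+ 2 = r ^+ 2] for
    [r = sqrt (a ^+ 2 + b ^+ 2)], and the exponent of the method is [c + S] for
    a scalar [c], so that [exp (c + S) = e^c (cosh r + (sinh r / r) S)]. Given
    the past, [(DW_1, DW_2)] and its opposite have the same law; averaging the two
    removes the terms odd in [S] and leaves
    [E |y_(n+1)|^2 = e^(2 c) E [cosh (2 r) |y_n|^2]].
    Since [u |-> cosh (sqrt u)] is convex, [cosh (2 r)] is at most a convex
    combination of [cosh (t DW_1)] and [cosh (t DW_2)] where
    [t ^+ 2 = 4 (sigma1 ^+ 2 + sigma2 ^+ 2)], and [E cosh (t DW_j)] is
    [exp (2 (sigma1 ^+ 2 + sigma2 ^+ 2) h)] by the Gaussian Laplace transform.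
    Altogether [E |y_(n+1)|^2 <= rho E |y_n|^2] with
    [rho = exp ((2 lambda + sigma1 ^+ 2 + sigma2 ^+ 2) h) < 1]. *)

Require Import Defs.
From HB Require Import structures.
From mathcomp Require Import all_boot all_order all_algebra.
From mathcomp Require Import all_classical all_reals all_analysis.
From mathcomp Require Import measurable_realfun ring lra.

Set Implicit Arguments.
Unset Strict Implicit.
Unset Printing Implicit Defensive.

Import Order.TTheory GRing.Theory Num.Theory.
Import numFieldNormedType.Exports.

Local Open Scope classical_set_scope.
Local Open Scope ring_scope.

(** * The exponential of a traceless symmetric matrix *)

(** By induction: multiplying the bound for [n] by [p * u + q * v] leaves a gap
    [p * q * ((u - v) * (u ^+ n - v ^+ n))], which is nonnegative since both differences have the
    same sign. *)
Lemma exprn_convex (R : realFieldType) (p q u v : R) (n : nat) :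
  0 <= p -> 0 <= q -> p + q = 1 -> 0 <= u -> 0 <= v ->
  (p * u + q * v) ^+ n <= p * u ^+ n + q * v ^+ n.
Proof.
move=> p0 q0 pq u0 v0; elim: n => [|n ih]; first by rewrite !expr0 !mulr1 pq.
rewrite exprS; apply: (@le_trans _ _ ((p * u + q * v) * (p * u ^+ n + q * v ^+ n))).
  by rewrite ler_wpM2l// addr_ge0// mulr_ge0.
have qE : q = 1 - p by rewrite -pq addrAC subrr add0r.
rewrite -subr_ge0 !exprS qE.
rewrite [leRHS](_ : _ = p * q * ((u - v) * (u ^+ n - v ^+ n))); last by rewrite qE; ring.
apply: mulr_ge0; first exact: mulr_ge0.
have [uv|/ltW vu] := leP u v.
- by apply: mulr_le0; rewrite subr_le0// lerXn2r.
- by apply: mulr_ge0; rewrite subr_ge0// lerXn2r.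
Qed.

(** This is convexity of [u |-> cosh (sqrt u)], doubled. It holds term by term in the exponential
    series: odd powers cancel, and even powers are powers of the squares, which are convex. *)
Lemma expR_sqrt_convex (R : realType) (p q u v : R) :
  0 <= p -> 0 <= q -> p + q = 1 ->
  let r := Num.sqrt (p * u ^+ 2 + q * v ^+ 2) in
  expR r + expR (- r) <=
  p * (expR u + expR (- u)) + q * (expR v + expR (- v)).
Proof.
move=> p0 q0 pq /=; set r := Num.sqrt _.
have cvgE (x : R) : (series (exp_coeff x) \+ series (exp_coeff (- x))) n
    @[n --> \oo] --> expR x + expR (- x).
  by apply: cvgD; exact: is_cvg_series_exp_coeff.
have cvgR : (p * (series (exp_coeff u) \+ series (exp_coeff (- u))) n +
    q * (series (exp_coeff v) \+ series (exp_coeff (- v))) n) @[n --> \oo] -->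
    p * (expR u + expR (- u)) + q * (expR v + expR (- v)).
  by apply: cvgD; apply: cvgM; [exact: cvg_cst|exact: cvgE
                               |exact: cvg_cst|exact: cvgE].
apply: (ler_cvg_to (cvgE r) cvgR); apply: nearW => n /=.
rewrite /series /= -!big_split/= !mulr_sumr -big_split/=.
apply: ler_sum => i _; rewrite /exp_coeff/= -!mulrDl !mulrA -mulrDl.
rewrite ler_wpM2r ?invr_ge0//.
have evenE (x : R) k : x ^+ k.*2 + (- x) ^+ k.*2 = 2 * (x ^+ 2) ^+ k.
  by rewrite -!mul2n !exprM sqrrN mulrDl !mul1r.
(* Split by the parity of the degree [i] of the term. *)
rewrite -(odd_double_half i); case: (odd i) => /=.
  have oddE (x : R) k : x ^+ (1 + k.*2) + (- x) ^+ (1 + k.*2) = 0.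
    by rewrite !exprS -!mul2n !exprM sqrrN mulNr subrr.
  by rewrite !oddE !mulr0 addr0.
rewrite !add0n !evenE sqr_sqrtr; last by rewrite addr_ge0// mulr_ge0// sqr_ge0.
rewrite !(mulrCA _ 2) -mulrDr ler_pM2l//.
by apply: exprn_convex => //; exact: sqr_ge0.
Qed.

Lemma cvg_exp_series (R : realType) (x : R) :
  series (exp_coeff x) n @[n --> \oo] --> expR x.
Proof. exact: is_cvg_series_exp_coeff. Qed.

Section expmx_quadratic.
Variables (R : realType) (k : nat) (S : 'M[R]_k.+1) (c r : R).
Hypotheses (S2 : S ^+ 2 = (r ^+ 2) *: 1) (S0 : r = 0 -> S = 0).

(** [S] has eigenvalues [r] and [- r], so the power is obtained by interpolating [x ^+ n] linearly
    at [c + r] and [c - r]. If [r = 0], the quotient is [0] by the convention for division and [S]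
    vanishes as well. *)
Lemma exprn_quadratic n :
  (c *: 1 + S) ^+ n = (((c + r) ^+ n + (c - r) ^+ n) / 2) *: 1 +
                      (((c + r) ^+ n - (c - r) ^+ n) / (2 * r)) *: S.
Proof.
have [r0|r0] := eqVneq r 0.
  rewrite S0// r0 scaler0 !addr0 subr0.
  by rewrite exprZn expr1n; congr (_ *: _); lra.
elim: n => [|n ih].
  by rewrite !expr0 subrr mul0r scale0r addr0 -[LHS]scale1r; congr (_ *: _); lra.
(* The span of [1] and [S] is closed under products because [S ^+ 2] is scalar. *)
have mulE (a b : R) : (c *: 1 + S) * (a *: 1 + b *: S) =
    (c * a + r ^+ 2 * b) *: 1 + (a + c * b) *: S.
  rewrite mulrDl !mulrDr -!scalerAl !mul1r -!scalerAr mulr1 -expr2 S2 !scalerA.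
  by rewrite [X in _ + X]addrC addrACA -!scalerDl [b * _]mulrC [c * b + _]addrC.
by rewrite exprS ih mulE; congr (_ *: _ + _ *: _); rewrite !exprS; field.
Qed.

(** By [exprn_quadratic], the partial sums are combinations of [1] and [S] whose coefficients are
    partial sums of the scalar exponential series at [c + r] and [c - r]. *)
Lemma expmx_quadratic :
  expmx (c *: 1 + S) = ((expR (c + r) + expR (c - r)) / 2) *: 1 +
                       ((expR (c + r) - expR (c - r)) / (2 * r)) *: S.
Proof.
apply/cvg_lim => //.
rewrite (_ : series _ = fun n =>
   ((series (exp_coeff (c + r)) n + series (exp_coeff (c - r)) n) / 2) *: 1 +
   ((series (exp_coeff (c + r)) n - series (exp_coeff (c - r)) n) / (2 * r)) *: S).
  apply: cvgD; apply: cvgZr_tmp; (apply: cvgM; last exact: cvg_cst).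
    by apply: cvgD; exact: cvg_exp_series.
  by apply: cvgB; exact: cvg_exp_series.
apply/funext => n; rewrite /series/= -big_split/= -sumrB !mulr_suml !scaler_suml.
rewrite -big_split; apply: eq_bigr => i _ /=.
rewrite exprn_quadratic scalerDr !scalerA /exp_coeff/=.
by congr (_ *: _ + _ *: _); ring.
Qed.

End expmx_quadratic.

(** * ** One step of the method for the test equation *)

Lemma mulmx22 (R : realType) (a b c e a' b' c' e' : R) :
  mx22 a b c e *m mx22 a' b' c' e' =
  mx22 (a * a' + b * c') (a * b' + b * e') (c * a' + e * c') (c * b' + e * e').
Proof.
apply/matrixP => i j; rewrite !mxE !big_ord_recl big_ord0 !mxE/= addr0.
by case: i => [[|[|//]] ?]; case: j => [[|[|//]] ?].
Qed.

Definition symm_mx (R : realType) (a b : R) : 'M[R]_2 := mx22 a b b (- a).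

Section test_equation.
Variables (R : realType) (lambda sigma1 sigma2 h : R).

Lemma test_diffusion_sqr j : test_diffusion sigma1 sigma2 j ^+ 2 =
  (if j == 0 then sigma1 ^+ 2 else sigma2 ^+ 2) *: 1.
Proof.
rewrite /test_diffusion expr2; case: ifP => _; rewrite -[LHS]/(_ *m _) mulmx22;
apply/matrixP => i l; rewrite !mxE;
by case: i => [[|[|//]] ?]; case: l => [[|[|//]] ?]; rewrite /= ?mulr1n ?mulr0n; ring.
Qed.

Lemma magnus_exponent_test (dW : 'I_2 -> R) :
  magnus_exponent (test_drift lambda) (test_diffusion sigma1 sigma2) h dW =
  (h * (lambda - (sigma1 ^+ 2 + sigma2 ^+ 2) / 2)) *: 1 +
  symm_mx (sigma1 * dW 0) (sigma2 * dW 1).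
Proof.
rewrite /magnus_exponent !big_ord_recl !big_ord0 !test_diffusion_sqr.
have -> : lift ord0 ord0 = 1 :> 'I_2 by exact/val_inj.
rewrite /test_diffusion /test_drift /=.
apply/matrixP => i l; rewrite !mxE;
by case: i => [[|[|//]] ?]; case: l => [[|[|//]] ?]; rewrite /= ?mulr1n ?mulr0n; field.
Qed.

End test_equation.

Section exp_symm_mx.
Context (R : realType).
Implicit Types a b c u v : R.

Lemma symm_mx_sqr a b : symm_mx a b ^+ 2 = (Num.sqrt (a ^+ 2 + b ^+ 2) ^+ 2) *: 1.
Proof.
rewrite sqr_sqrtr ?addr_ge0 ?sqr_ge0// expr2 -[LHS]/(_ *m _) mulmx22.
apply/matrixP => i l; rewrite !mxE;
by case: i => [[|[|//]] ?]; case: l => [[|[|//]] ?]; rewrite /= ?mulr1n ?mulr0n; ring.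
Qed.

Lemma symm_mx_eq0 a b : Num.sqrt (a ^+ 2 + b ^+ 2) = 0 -> symm_mx a b = 0.
Proof.
move/eqP; rewrite sqrtr_eq0 => ab.
have ab0 : a ^+ 2 + b ^+ 2 == 0 by rewrite eq_le ab addr_ge0 ?sqr_ge0.
move: ab0; rewrite paddr_eq0 ?sqr_ge0// !sqrf_eq0 => /andP[/eqP -> /eqP ->].
apply/matrixP => i l; rewrite !mxE.
by case: i => [[|[|//]] ?]; case: l => [[|[|//]] ?]; rewrite /= ?oppr0.
Qed.

(* [e^c cosh r] and [e^c sinh r / r]; the latter is [0] at [r = 0], where it only
   multiplies [symm_mx 0 0 = 0]. *)
Definition ecosh (c a b : R) : R :=
  let r := Num.sqrt (a ^+ 2 + b ^+ 2) in (expR (c + r) + expR (c - r)) / 2.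

Definition esinhc (c a b : R) : R :=
  let r := Num.sqrt (a ^+ 2 + b ^+ 2) in (expR (c + r) - expR (c - r)) / (2 * r).

Definition step0 (c a b u v : R) : R :=
  ecosh c a b * u + esinhc c a b * (a * u + b * v).
Definition step1 (c a b u v : R) : R :=
  ecosh c a b * v + esinhc c a b * (b * u - a * v).

Lemma expmx_symm_mulE c a b (y : 'cV[R]_2) :
  let z := expmx (c *: 1 + symm_mx a b) *m y in
  z 0 0 = step0 c a b (y 0 0) (y 1 0) /\ z 1 0 = step1 c a b (y 0 0) (y 1 0).
Proof.
rewrite /= (expmx_quadratic c (symm_mx_sqr a b) (@symm_mx_eq0 a b)).
rewrite -/(ecosh c a b) -/(esinhc c a b).
by split; rewrite !mxE !big_ord_recl big_ord0 !mxE;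
  (have -> : lift ord0 ord0 = 1 :> 'I_2 by exact/val_inj);
  rewrite -[ord0]/(0 : 'I_2) /= /step0 /step1 ?mulr1n ?mulr0n; ring.
Qed.

(* The terms odd in [(a, b)] cancel, and what is left only involves the
   eigenvalues [c + r] and [c - r]. *)
Lemma step_symmetrized c a b u v :
  let r := Num.sqrt (a ^+ 2 + b ^+ 2) in
  step0 c a b u v ^+ 2 + step1 c a b u v ^+ 2 +
  (step0 c (- a) (- b) u v ^+ 2 + step1 c (- a) (- b) u v ^+ 2) =
  expR (2 * c) * (expR (2 * r) + expR (- (2 * r))) * (u ^+ 2 + v ^+ 2).
Proof.
move=> r.
have rE : r ^+ 2 = a ^+ 2 + b ^+ 2 by rewrite sqr_sqrtr ?addr_ge0 ?sqr_ge0.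
have -> : expR (2 * c) * (expR (2 * r) + expR (- (2 * r))) =
    expR (c + r) ^+ 2 + expR (c - r) ^+ 2.
  rewrite mulrDr -!expRD -!expRM_natl; congr (expR _ + expR _); ring.
rewrite /step0 /step1 /ecosh /esinhc !sqrrN -/r.
set E := expR (c + r); set G := expR (c - r).
(* At [r = 0] the two exponentials coincide, so the coefficient of the traceless part is [0]. *)
have [r0|r0] := eqVneq r 0.
  have : E = G by rewrite /E /G r0 subr0 addr0.
  by move=> ->; rewrite subrr !mul0r; field.
set D := (E - G) / (2 * r).
have DE : r * D = (E - G) / 2 by rewrite /D; field.
have D2 : D ^+ 2 * (a ^+ 2 + b ^+ 2) = ((E - G) / 2) ^+ 2 by rewrite -rE -DE; ring.
transitivity (2 * (((E + G) / 2) ^+ 2 + D ^+ 2 * (a ^+ 2 + b ^+ 2)) * (u ^+ 2 + v ^+ 2)).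
  by ring.
by rewrite D2; field.
Qed.

End exp_symm_mx.

(** * Independence and Gaussian integrals *)

Section independent_law.
Context d d1 d2 (T : measurableType d) (T1 : measurableType d1)
  (T2 : measurableType d2) (R : realType) (P : probability T R).
Variables (X : {mfun T >-> T1}) (Z : {mfun T >-> T2}).
Hypothesis XZ : forall A B, measurable A -> measurable B ->
  (P (X @^-1` A `&` Z @^-1` B) = P (X @^-1` A) * P (Z @^-1` B))%E.

(** Independence on rectangles identifies the joint law of [(X, Z)] with the product of the marginal
    laws; Tonelli's theorem does the rest. *)
Lemma ge0_integral_independent (f : T1 * T2 -> \bar R) :
  measurable_fun setT f -> (forall x, 0 <= f x)%E ->
  (\int[P]_w f (X w, Z w) =
   \int[distribution P Z]_z \int[distribution P X]_x f (x, z))%E.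
Proof.
move=> mf f0.
have mXZ : measurable_fun setT (fun w => (X w, Z w)).
  exact: measurable_fun_pair.
pose g : {mfun T >-> (T1 * T2)%type} :=
  HB.pack (fun w => (X w, Z w)) (isMeasurableFun.Build _ _ _ _ _ mXZ).
rewrite -(fubini_tonelli2 f mf f0) -[LHS](ge0_integral_distribution g mf f0).
apply: eq_measure_integral => A mA _; exact/esym/product_measure_unique.
Qed.

Lemma ge0_integral_independentM (f : T1 -> \bar R) (g : T2 -> \bar R) :
  measurable_fun setT f -> measurable_fun setT g ->
  (forall x, 0 <= f x)%E -> (forall x, 0 <= g x)%E ->
  (\int[P]_w (f (X w) * g (Z w)) =
   (\int[distribution P X]_x f x) * (\int[P]_w g (Z w)))%E.
Proof.
move=> mf mg f0 g0.
rewrite (@ge0_integral_independent (fun p => f p.1 * g p.2)%E) /=; first last.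
- by move=> x; exact: mule_ge0.
- by apply: emeasurable_funM; apply: measurableT_comp.
under eq_integral do rewrite ge0_integralZr//.
rewrite ge0_integralZl//; last by apply: integral_ge0.
by congr (_ * _)%E; rewrite ge0_integral_distribution.
Qed.

End independent_law.

(** With the value of [Z] frozen, the inner integral depends only on the law of [X], which is
    invariant under reflection. This replaces conditioning on the past. *)
Lemma ge0_integral_independentN d d2 (T : measurableType d)
  (T2 : measurableType d2) (R : realType) (P : probability T R)
  (X : {mfun T >-> R}) (Z : {mfun T >-> T2}) (f : R * T2 -> \bar R) :
  (forall A B, measurable A -> measurable B ->
    P (X @^-1` A `&` Z @^-1` B) = P (X @^-1` A) * P (Z @^-1` B))%E ->
  (forall A : set R, measurable A ->
    distribution P X (-%R @^-1` A) = distribution P X A) ->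
  measurable_fun setT f -> (forall x, 0 <= f x)%E ->
  (\int[P]_w f (X w, Z w) = \int[P]_w f ((- X w)%R, Z w))%E.
Proof.
move=> XZ XN mf f0.
have mfN : measurable_fun setT (fun p : R * T2 => f (- p.1, p.2)).
  apply: (measurableT_comp mf (g := fun p : R * T2 => (- p.1, p.2))).
  apply: measurable_fun_pair => //.
  exact: (measurable_funN measurable_fst).
rewrite (ge0_integral_independent XZ mf f0).
rewrite (ge0_integral_independent XZ mfN (fun p => f0 _)).
apply: eq_integral => z _ /=.
have mfz : measurable_fun setT (fun x => f (x, z)).
  exact: measurable_fun_pair1.
rewrite -[RHS](@ge0_integral_pushforward _ _ _ _ _ (-%R : R -> R)
  _ _ setT (fun x => f (x, z)))//.
by apply: eq_measure_integral => A mA _; exact/esym/XN.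
Qed.

(** * ** Symmetry and Laplace transform of the normal law *)

Section normal.
Context (R : realType) (s : R).
Hypothesis s0 : s != 0.
Let mu := @lebesgue_measure R.

(** The centred density is even and Lebesgue measure is invariant under reflection. *)
Lemma normal_probN (A : set R) : measurable A ->
  normal_prob 0 s (-%R @^-1` A) = normal_prob 0 s A.
Proof.
move=> mA; rewrite /normal_prob.
have mNp : measurable_fun A (fun x => (normal_pdf 0 s x)%:E).
  by apply/measurable_EFinP/measurable_funTS; exact: measurable_normal_pdf.
transitivity (\int[mu]_(x in -%R @^-1` A) (normal_pdf 0 s (- x)%R)%:E)%E.
  by apply: eq_integral => x _; rewrite !normal_pdfE// /normal_fun !subr0 sqrrN.
have mopp : measurable_fun setT (-%R : measurableTypeR R -> measurableTypeR R).
  exact: measurable_funN.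
rewrite -[LHS](ge0_integral_pushforward mopp mu mA mNp).
  by apply: eq_measure_integral => B mB _; exact: lebesgue_measureN.
by move=> x _; rewrite lee_fin normal_pdf_ge0.
Qed.

(** The change of variables is available for the Radon-Nikodym derivative; this agrees almost
    everywhere with the Gaussian density, as both have the same integral over every measurable
    set. *)
Lemma ge0_integral_normal_prob m (f : R -> \bar R) :
  measurable_fun setT f -> (forall x, 0 <= f x)%E ->
  (\int[normal_prob m s]_x f x = \int[mu]_x (f x * (normal_pdf m s x)%:E))%E.
Proof.
move=> mf f0.
have dom := normal_prob_dominates m s.
rewrite -(Radon_Nikodym_SigmaFinite.change_of_variables dom)//=.
have mRN : mu.-integrable setT (Radon_Nikodym_SigmaFinite.f (normal_prob m s) mu).
  exact: Radon_Nikodym_SigmaFinite.f_integrable.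
apply: ge0_ae_eq_integral => //.
- by apply: emeasurable_funM => //; exact: measurable_int mRN.
- apply: emeasurable_funM => //; apply/measurable_EFinP.
  exact: measurable_normal_pdf.
- by move=> x _; rewrite mule_ge0// Radon_Nikodym_SigmaFinite.f_ge0.
- by move=> x _; rewrite mule_ge0// lee_fin normal_pdf_ge0.
apply: ae_eqe_mul2l; apply: integral_ae_eq; [by []|by []| |].
  by apply/measurable_EFinP; exact: measurable_normal_pdf.
move=> E _ mE.
by rewrite -Radon_Nikodym_SigmaFinite.f_integral.
Qed.

(** Completing the square: tilting the centred density by [expR (t * x)] gives a constant times the
    density of mean [t * s ^+ 2], whose integral is [1]. *)
Lemma normal_prob_mgf t :
  (\int[normal_prob 0 s]_x (expR (t * x))%:E = (expR (t ^+ 2 * s ^+ 2 / 2))%:E)%E.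
Proof.
rewrite ge0_integral_normal_prob; last 2 first.
- by apply/measurable_EFinP; do 2 apply: measurableT_comp => //.
- by move=> x; rewrite lee_fin expR_ge0.
transitivity (\int[mu]_x ((expR (t ^+ 2 * s ^+ 2 / 2))%:E *
    (normal_pdf (t * s ^+ 2) s x)%:E))%E.
  apply: eq_integral => x _; rewrite -!EFinM; congr EFin.
  rewrite !normal_pdfE// mulrCA [RHS]mulrCA; congr (_ * _).
  rewrite /normal_fun -!expRD; congr expR.
  by field.
rewrite ge0_integralZl//.
- by rewrite integral_normal_pdf mule1.
- by apply/measurable_EFinP; exact: measurable_normal_pdf.
- by move=> x _; rewrite lee_fin normal_pdf_ge0.
Qed.

End normal.

(** * ** Independence of sigma-algebras *)

Section systems.
Context (R : realType) (d : measure_display) (T : measurableType d).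

(** Lets measurability with respect to a sub-sigma-algebra [H] be handled by the usual closure
    lemmas, on the type [g_sigma_algebraType H]. *)
Lemma sigma_algebra_measurable_funP (H : set_system T) (f : T -> R) :
  sigma_algebra setT H ->
  measurable_fun setT (f : g_sigma_algebraType H -> R) <->
  preimage_set_system setT f measurable `<=` H.
Proof.
move=> sH; split => [mf _ [B mB <-]|fH _ B mB].
  by have := mf measurableT B mB; rewrite measurable_g_measurableTypeE.
by rewrite measurable_g_measurableTypeE//; apply: fH; exists B.
Qed.

Lemma sigma_of_sub (I : Type) (D : set I) (X : I -> T -> R) (H : set_system T) :
  sigma_algebra setT H ->
  (forall i, D i -> measurable_fun setT (X i : g_sigma_algebraType H -> R)) ->
  sigma_of D X `<=` H.
Proof.
move=> sH XH; apply: smallest_sub => // A [i Di].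
by have /(sigma_algebra_measurable_funP _ sH) := XH i Di; exact.
Qed.

Lemma sigma_algebra_sigma_of (I : Type) (D : set I) (X : I -> T -> R) :
  sigma_algebra setT (sigma_of D X).
Proof. exact: smallest_sigma_algebra. Qed.

Lemma measurable_sigma_of (I : Type) (D : set I) (X : I -> T -> R) i : D i ->
  measurable_fun setT (X i : g_sigma_algebraType (sigma_of D X) -> R).
Proof.
move=> Di; apply/(sigma_algebra_measurable_funP _ (sigma_algebra_sigma_of D X)).
by move=> A XA; apply: sub_gen_smallest; exists i.
Qed.

Variable P : probability T R.

Lemma independent_systems_sym (G H : set_system T) :
  independent_systems P G H -> independent_systems P H G.
Proof. by move=> GH A B HA GB; rewrite setIC GH// muleC. Qed.

Lemma independent_systems_sub (G G' H H' : set_system T) :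
  G' `<=` G -> H' `<=` H ->
  independent_systems P G H -> independent_systems P G' H'.
Proof. by move=> GG HH GH A B /GG GA /HH HB; exact: GH. Qed.

(** For fixed [A], the measurable sets independent of [A] form a Dynkin system; Dynkin's theorem
    applies since [H] is stable under intersection. *)
Lemma independent_systems_sigma (G H : set_system T) :
  G `<=` measurable -> H `<=` measurable -> setI_closed H ->
  independent_systems P G H -> independent_systems P G <<s H >>.
Proof.
move=> mG mH HI GH A B GA.
have mA := mG A GA.
have sHm : <<s H >> `<=` measurable.
  by apply: smallest_sub => //; exact: sigma_algebra_measurable.
suff : <<s H >> `<=` [set C | measurable C /\ P (A `&` C) = (P A * P C)%E].
  by move=> /[apply] -[].
rewrite -setI_closed_g_dynkin_g_sigma_algebra//.
apply: smallest_sub; last by move=> C HC; split; [exact: mH|exact: GH].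
split => [|C [mC AC]|C tC HC].
- by split => //; rewrite setIT probability_setT mule1.
- split; first exact: measurableC.
  rewrite -setDE measureD//; last by rewrite ltey_eq fin_num_measure.
  transitivity (P A - P A * P C)%E; first by congr (_ - _)%E; exact: AC.
  rewrite probability_setC// muleBr ?mule1//.
  by rewrite fin_num_measure.
- split; first by apply: bigcup_measurable => k _; case: (HC k).
  have mC k : setT k -> measurable (C k) by move=> _; case: (HC k).
  have mAC k : setT k -> measurable (A `&` C k).
    by move=> _; apply: measurableI => //; case: (HC k).
  have tAC : trivIset setT (fun k => A `&` C k) by exact: trivIset_setIl.
  rewrite setI_bigcupr !measure_bigcup//.
  rewrite -[P A]fineK ?fin_num_measure// -nneseriesZl; last first.
    by move=> k _; exact: measure_ge0.
  by apply: eq_eseriesr => k _; rewrite fineK ?fin_num_measure//; case: (HC k).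
Qed.

(* Applied with [A] a new increment of one Wiener process, [B1] the past of
   that process, [B2] the other process and [B0] the initial value. *)
Lemma independent_systems_chain (A B0 B1 B2 M N : set_system T) :
  [/\ sigma_algebra setT B0, sigma_algebra setT B1 & sigma_algebra setT B2] ->
  [/\ sigma_algebra setT M & sigma_algebra setT N] ->
  [/\ B0 `<=` measurable, M `<=` measurable & N `<=` measurable] ->
  [/\ A `<=` N, B1 `<=` N & N `<=` M] -> B2 `<=` M ->
  independent_systems P B0 M -> independent_systems P N B2 ->
  independent_systems P B1 A ->
  independent_systems P A
    <<s [set C | exists b0 b1 b2,
           [/\ B0 b0, B1 b1, B2 b2 & C = b0 `&` (b1 `&` b2)] ]>>.
Proof.
move=> [s0 s1 s2] [sM sN] [m0 mM mN] [AN B1N NM] B2M i0M iN2 i1A.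
have setIsigma (H : set_system T) : sigma_algebra setT H -> setI_closed H.
  move=> sH B C; rewrite -(measurable_g_measurableTypeE sH); exact: measurableI.
apply: independent_systems_sigma.
- by move=> a /AN/mN.
- move=> _ [b0 [b1 [b2 [h0 h1 h2 ->]]]].
  by do 2 (apply: measurableI; [by auto|]); apply: mM; exact: B2M.
- move=> _ _ [b0 [b1 [b2 [h0 h1 h2 ->]]]] [c0 [c1 [c2 [k0 k1 k2 ->]]]].
  exists (b0 `&` c0), (b1 `&` c1), (b2 `&` c2); split; try exact: setIsigma.
  by rewrite setIACA [in X in _ `&` X]setIACA.
move=> a _ Aa [b0 [b1 [b2 [h0 h1 h2 ->]]]].
have NI := setIsigma _ sN; have MI := setIsigma _ sM.
have Na := AN _ Aa; have N1 := B1N _ h1; have M2 := B2M _ h2.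
have -> : a `&` (b0 `&` (b1 `&` b2)) = b0 `&` ((b1 `&` a) `&` b2).
  by rewrite setICA; congr (_ `&` _); rewrite setIA [a `&` _]setIC.
have Mb : M (b1 `&` a `&` b2) by apply: (MI _ _ _ M2); apply: NM; exact: NI.
(* Split off [b0] by independence from [M], then [b2] by independence from [N], then separate [b1]
   from [a]. The first two splits applied to the right-hand side match the factors. *)
rewrite i0M//.
rewrite iN2//; last exact: NI.
rewrite i1A// i0M//; last by apply: (MI _ _ _ M2); exact: NM.
rewrite iN2// [(P b1 * P a)%E]muleC -muleA; exact: muleCA.
Qed.

End systems.

(** * ** Wiener increments and the past *)

Section wiener_increments.
Context (R : realType) (d : measure_display) (T : measurableType d)
  (P : probability T R) (F : R -> set_system T) (W : 'I_2 -> R -> T -> R).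
Hypothesis hW : standard_wiener_pair P F W.

Lemma measurable_wiener_filtration j t s : 0 <= t -> t <= s ->
  measurable_fun setT (W j t : g_sigma_algebraType (F s) -> R).
Proof.
move: hW => [[sF mF ndF] wW _] t0 ts.
apply/(sigma_algebra_measurable_funP _ (sF _ (le_trans t0 ts))).
by apply: (subset_trans (wiener_adapted (wW j) t0)); exact: ndF.
Qed.

Lemma measurable_wiener j t : 0 <= t -> measurable_fun setT (W j t).
Proof.
move: hW => [[sF mF ndF] wW _] t0 _ B mB.
by apply: (mF _ t0); apply: (wiener_adapted (wW j) t0); exists B.
Qed.

Lemma independent_wiener_pair j j' : j != j' ->
  independent_systems P (sigma_of `[0, +oo[ (W j)) (sigma_of `[0, +oo[ (W j')).
Proof.
move: hW => [_ _ W01].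
have [->|j0] := eqVneq j 0; have [->|j'0] := eqVneq j' 0 => //.
- suff -> : j' = 1 by [].
  by apply/val_inj; case: j' j'0 {W01} => [[|[|//]] ?].
- suff -> : j = 1 by move=> _; exact: independent_systems_sym.
  by apply/val_inj; case: j j0 {W01} => [[|[|//]] ?].
- by case: j j0 => [[|[|//]] ?]; case: j' j'0 => [[|[|//]] ?].
Qed.

(** [G] gathers the initial value, the past of [W j] and the whole of [W j']. Including the future
    of [W j'] makes the new increment of [W j] independent of the state together with the
    simultaneous increment of [W j']. *)
Lemma wiener_increment_past k (y0 : T -> 'cV[R]_k) j j' s t :
  random_vector y0 -> independent_of_increments P W y0 ->
  j != j' -> 0 <= s -> s < t ->
  exists G : set_system T,
  [/\ independent_systems P
        (preimage_set_system setT (W j t \- W j s) measurable) <<s G>>,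
      <<s G >> `<=` measurable,
      @random_vector R _ (g_sigma_algebraType G) k y0,
      (forall u v, 0 <= u -> 0 <= v -> v <= s -> u <= s -> 
        measurable_fun setT (W j u \- W j v : g_sigma_algebraType G -> R)) &
      (forall u v, 0 <= u -> 0 <= v -> 
        measurable_fun setT (W j' u \- W j' v : g_sigma_algebraType G -> R))].
Proof.
move=> my0 y0W jj' s0 st.
have [[sF mF ndF] wW _] := hW.
have t0 : 0 <= t := le_trans s0 (ltW st).
(* Paths are measured from their value at time [0], since [y0] is independent of these differences
   only. *)
pose D i u : T -> R := W i u \- W i 0.
pose B0 := sigma_of setT (fun (i : 'I_k) w => y0 w i 0).
pose B1 := sigma_of [set u | 0 <= u <= s] (D j).
pose B2 := sigma_of [set u | 0 <= u] (D j').
pose M := sigma_of [set p : 'I_2 * R | 0 <= p.2] (fun p => D p.1 p.2).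
pose N := sigma_of [set u | 0 <= u] (D j).
pose Pi := [set C | exists b0 b1 b2,
  [/\ B0 b0, B1 b1, B2 b2 & C = b0 `&` (b1 `&` b2)] ].
have sB0 : sigma_algebra setT B0 by exact: sigma_algebra_sigma_of.
have sB1 : sigma_algebra setT B1 by exact: sigma_algebra_sigma_of.
have sB2 : sigma_algebra setT B2 by exact: sigma_algebra_sigma_of.
have sM : sigma_algebra setT M by exact: sigma_algebra_sigma_of.
have sN : sigma_algebra setT N by exact: sigma_algebra_sigma_of.
have sm := @sigma_algebra_measurable _ T.
have mD i u : 0 <= u -> measurable_fun setT (D i u).
  by move=> u0; apply: measurable_funB; exact: measurable_wiener.
have subm I (E : set I) (X : I -> T -> R) :
    (forall i, E i -> measurable_fun setT (X i)) -> sigma_of E X `<=` measurable.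
  move=> mX; apply: smallest_sub => // A [i Ei] [B mB <-].
  exact: (mX i Ei measurableT B mB).
have mB0 : B0 `<=` measurable by apply: subm => i _; exact: my0.
have mM : M `<=` measurable by apply: subm => p p0; exact: mD.
have mN : N `<=` measurable by apply: subm => u u0; exact: mD.
have NM i : sigma_of [set u | 0 <= u] (D i) `<=` M.
  apply: (sigma_of_sub sM) => u u0.
  exact: (@measurable_sigma_of _ _ _ _ [set p : 'I_2 * R | 0 <= p.2]
    (fun p => D p.1 p.2) (i, u) u0).
have B1N : B1 `<=` N.
  apply: (sigma_of_sub sN) => u /andP[u0 _].
  exact: (@measurable_sigma_of _ _ _ _ [set u | 0 <= u] (D j) u u0).
have incrE i u v : W i u \- W i v = D i u \- D i v.
  by apply/funext => w; rewrite /D /= opprB addrA subrK.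
have NW i : sigma_of [set u | 0 <= u] (D i) `<=` sigma_of `[0, +oo[ (W i).
  apply: sigma_of_sub; first exact: sigma_algebra_sigma_of.
  move=> u u0.
  by apply: measurable_funB; apply: measurable_sigma_of; rewrite /= in_itv/= andbT.
have AN : preimage_set_system setT (W j t \- W j s) measurable `<=` N.
  apply/(sigma_algebra_measurable_funP _ sN); rewrite incrE.
  by apply: measurable_funB;
    exact: (@measurable_sigma_of _ _ _ _ [set u | 0 <= u] (D j)).
(* The past of [W j] lies in [F s], so independence of the increment from the filtration applies to
   it. *)
have B1F : B1 `<=` F s.
  apply: (sigma_of_sub (sF _ s0)) => u /andP[u0 us].
  by apply: measurable_funB; exact: measurable_wiener_filtration.
have iA : independent_systems P
    (preimage_set_system setT (W j t \- W j s) measurable) <<s Pi >>.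
  apply: (independent_systems_chain (M := M) (N := N)) => //.
  - by split => //; exact: NM.
  - exact: NM.
  - by apply: (independent_systems_sub _ _ (independent_wiener_pair jj')); exact: NW.
  - apply: (independent_systems_sub B1F _ (wiener_increment_indep (wW j) s0 st)).
    exact: subset_refl.
(* Taking the whole space for two of the three factors embeds each of [B0], [B1] and [B2] in
   [Pi]. *)
have T0 (H : set_system T) : sigma_algebra setT H -> H setT.
  by move=> sH; rewrite -(measurable_g_measurableTypeE sH); exact: measurableT.
have sPi : sigma_algebra setT <<s Pi >> by exact: smallest_sigma_algebra.
have B0Pi : B0 `<=` Pi.
  by move=> b ?; exists b, setT, setT; split; [|exact: T0|exact: T0|rewrite !setIT].
have B1Pi : B1 `<=` Pi.
  by move=> b ?; exists setT, b, setT; split; [exact: T0| |exact: T0|rewrite setTI setIT].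
have B2Pi : B2 `<=` Pi.
  by move=> b ?; exists setT, setT, b; split; [exact: T0|exact: T0| |rewrite !setTI].
have lift_ (H : set_system T) (f : T -> R) : sigma_algebra setT H -> H `<=` Pi ->
    measurable_fun setT (f : g_sigma_algebraType H -> R) ->
    measurable_fun setT (f : g_sigma_algebraType Pi -> R).
  move=> sH HPi /(sigma_algebra_measurable_funP _ sH) fH _ B mB.
  by apply: sub_gen_smallest; apply: HPi; apply: fH; exists B.
exists Pi; split => //.
- apply: smallest_sub => // _ [b0 [b1 [b2 [h0 h1 h2 ->]]]].
  apply: measurableI; first exact: mB0.
  by apply: measurableI; apply: mM; [exact: (NM j _ (B1N _ h1))|exact: (NM j' _ h2)].
- move=> i; apply: (lift_ _ _ sB0 B0Pi).
  exact: (@measurable_sigma_of _ _ _ _ setT (fun (i : 'I_k) w => y0 w i 0)).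
- move=> u v u0 v0 vs us; rewrite incrE; apply: (lift_ _ _ sB1 B1Pi).
  by apply: measurable_funB; apply: measurable_sigma_of; apply/andP.
- move=> u v u0 v0; rewrite incrE; apply: (lift_ _ _ sB2 B2Pi).
  by apply: measurable_funB; apply: measurable_sigma_of.
Qed.

End wiener_increments.

(** * Mean-square contraction of one step *)

Section step_measurable.
Context (R : realType) (d : measure_display) (T : measurableType d).
Variables (c : R) (a b : T -> R).
Hypotheses (ma : measurable_fun setT a) (mb : measurable_fun setT b).

Let r w := Num.sqrt (a w ^+ 2 + b w ^+ 2).

Lemma measurable_hypot : measurable_fun setT r.
Proof.
apply: (measurableT_comp (f := @Num.sqrt R)).
  by apply: continuous_measurable_fun; exact: sqrt_continuous.
by apply: measurable_funD; exact: measurable_funX.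
Qed.

Let mE (e : R) : measurable_fun setT (fun w => expR (c + e * r w)).
Proof.
apply: measurableT_comp => //; apply: measurable_funD => //.
by apply: measurable_funM => //; exact: measurable_hypot.
Qed.

Lemma measurable_ecosh : measurable_fun setT (fun w => ecosh c (a w) (b w)).
Proof.
rewrite (_ : (fun w => _) =
    fun w => (expR (c + 1 * r w) + expR (c + (-1) * r w)) / 2).
  by apply: measurable_funM => //; exact: measurable_funD.
by apply/funext => w; rewrite /ecosh mul1r mulN1r.
Qed.

Lemma measurable_esinhc : measurable_fun setT (fun w => esinhc c (a w) (b w)).
Proof.
(* The inverse is written as a real power, whose measurability is known; the two agree on
   nonnegative numbers, including at [0]. *)
rewrite (_ : (fun w => _) = fun w =>
    (expR (c + 1 * r w) - expR (c + (-1) * r w)) * (2 * r w) `^ (-1)).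
  apply: measurable_funM; first exact: measurable_funB.
  apply: (measurableT_comp (measurable_powR (-1))).
  by apply: measurable_funM => //; exact: measurable_hypot.
apply/funext => w; rewrite /esinhc mul1r mulN1r powR_inv1//.
by rewrite mulr_ge0// sqrtr_ge0.
Qed.

Variables (u v : T -> R).
Hypotheses (mu : measurable_fun setT u) (mv : measurable_fun setT v).

Lemma measurable_step0 :
  measurable_fun setT (fun w => step0 c (a w) (b w) (u w) (v w)).
Proof.
apply: measurable_funD; apply: measurable_funM => //.
- exact: measurable_ecosh.
- exact: measurable_esinhc.
- by apply: measurable_funD; exact: measurable_funM.
Qed.

Lemma measurable_step1 :
  measurable_fun setT (fun w => step1 c (a w) (b w) (u w) (v w)).
Proof.
apply: measurable_funD; apply: measurable_funM => //.
- exact: measurable_ecosh.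
- exact: measurable_esinhc.
- by apply: measurable_funB; exact: measurable_funM.
Qed.

End step_measurable.

(** Apply [expR_sqrt_convex] at [t * x] and [t * y] with weights [sigma1 ^+ 2 / S] and
    [sigma2 ^+ 2 / S]: as [t ^+ 2 = 4 * S], the weighted mean of the squares is [(2 * r) ^+ 2]. *)
Lemma cosh_sum_le (R : realType) (sigma1 sigma2 x y : R)
    (S := sigma1 ^+ 2 + sigma2 ^+ 2)
    (r := Num.sqrt ((sigma1 * x) ^+ 2 + (sigma2 * y) ^+ 2))
    (t := 2 * Num.sqrt S) : sigma1 != 0 ->
  expR (2 * r) + expR (- (2 * r)) <=
  sigma1 ^+ 2 / S * (expR (t * x) + expR (- t * x)) +
  sigma2 ^+ 2 / S * (expR (t * y) + expR (- t * y)).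
Proof.
move=> s1.
have S0 : 0 < S by rewrite ltr_pwDl ?sqr_ge0// exprn_even_gt0.
have t2 : t ^+ 2 = 4 * S by rewrite exprMn sqr_sqrtr ?(ltW S0)//; ring.
have p0 : 0 <= sigma1 ^+ 2 / S by rewrite divr_ge0 ?sqr_ge0// ltW.
have q0 : 0 <= sigma2 ^+ 2 / S by rewrite divr_ge0 ?sqr_ge0// ltW.
have pq : sigma1 ^+ 2 / S + sigma2 ^+ 2 / S = 1.
  by rewrite -mulrDl divff// gt_eqF.
have tE : sigma1 ^+ 2 / S * (t * x) ^+ 2 + sigma2 ^+ 2 / S * (t * y) ^+ 2 =
    2 ^+ 2 * ((sigma1 * x) ^+ 2 + (sigma2 * y) ^+ 2).
  by rewrite !(exprMn _ t) t2; field; rewrite gt_eqF.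
have := expR_sqrt_convex (t * x) (t * y) p0 q0 pq.
by rewrite /= tE sqrtrM ?sqr_ge0// sqrtr_sqr ger0_norm// !mulNr.
Qed.

(* The library puts [normal_prob] on [measurableTypeR R], whose display differs
   from the one carried by [R], hence the detour through [Zs]. *)
Lemma ge0_integral_normal_law d (T : measurableType d) (R : realType)
    (P : probability T R) (Z : {mfun T >-> R}) (m s : R) (f : R -> \bar R) :
  (forall B : set R, measurable B -> distribution P Z B = normal_prob m s B) ->
  measurable_fun setT f -> (forall x, 0 <= f x)%E ->
  (\int[P]_w f (Z w) = \int[normal_prob m s]_x f x)%E.
Proof.
move=> lawZ mf f0.
have mZ : measurable_fun setT (Z : T -> measurableTypeR R).
  exact: (measurable_funP Z).
pose Zs : {mfun T >-> measurableTypeR R} :=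
  HB.pack (Z : T -> measurableTypeR R) (isMeasurableFun.Build _ _ _ _ _ mZ).
rewrite -[LHS](ge0_integral_distribution Zs mf f0).
by apply: eq_measure_integral => A mA _; exact: lawZ.
Qed.

Section contraction.
Context (R : realType) (d : measure_display) (T : measurableType d)
  (P : probability T R).
Variables (c h sigma1 sigma2 : R) (X Y : {mfun T >-> R}) (u v : T -> R).
Hypotheses (h0 : 0 < h) (s1 : sigma1 != 0).
Hypotheses (mu : measurable_fun setT u) (mv : measurable_fun setT v).
Hypotheses
  (lawX : forall B : set R, measurable B ->
    distribution P X B = normal_prob 0 (Num.sqrt h) B)
  (lawY : forall B : set R, measurable B ->
    distribution P Y B = normal_prob 0 (Num.sqrt h) B).
Hypotheses
  (indepX : forall (A : set R) (B : set (R * (R * R))),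
    measurable A -> measurable B ->
    (P (X @^-1` A `&` (fun w => (Y w, (u w, v w))) @^-1` B) =
     P (X @^-1` A) * P ((fun w => (Y w, (u w, v w))) @^-1` B))%E)
  (indepY : forall (A : set R) (B : set (R * (R * R))),
    measurable A -> measurable B ->
    (P (Y @^-1` A `&` (fun w => (X w, (u w, v w))) @^-1` B) =
     P (Y @^-1` A) * P ((fun w => (X w, (u w, v w))) @^-1` B))%E).

Definition sq_step (x y a b : R) : R :=
  step0 c (sigma1 * x) (sigma2 * y) a b ^+ 2 +
  step1 c (sigma1 * x) (sigma2 * y) a b ^+ 2.

(** The space [U] is arbitrary so as to cover both [T] and the product space of values of
    [(X, (Y, (u, v)))]. *)
Lemma measurable_sq_step d' (U : measurableType d') (x y a b : U -> R) :
  measurable_fun setT x -> measurable_fun setT y ->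
  measurable_fun setT a -> measurable_fun setT b ->
  measurable_fun setT (fun w => (sq_step (x w) (y w) (a w) (b w))%:E).
Proof.
move=> mx my ma mb; apply/measurable_EFinP.
by apply: measurable_funD; apply: measurable_funX;
  [apply: measurable_step0|apply: measurable_step1] => //; exact: measurable_funM.
Qed.

Lemma sq_step_ge0 x y a b : (0 <= (sq_step x y a b)%:E)%E.
Proof. by rewrite lee_fin addr_ge0 ?sqr_ge0. Qed.

(** The signs are flipped one at a time: first that of [X] with [Y], [u], [v] frozen, then that of
    [Y] with [X] already negated. *)
Lemma integral_sq_stepN :
  (\int[P]_w (sq_step (X w) (Y w) (u w) (v w))%:E =
   \int[P]_w (sq_step (- X w) (- Y w) (u w) (v w))%:E)%E.
Proof.
have pack (Z : {mfun T >-> R}) :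
    measurable_fun setT (fun w => (Z w, (u w, v w))).
  by apply: measurable_fun_pair => //; exact: measurable_fun_pair.
have lawN (Z : {mfun T >-> R}) : (forall B : set R, measurable B ->
    distribution P Z B = normal_prob 0 (Num.sqrt h) B) ->
    forall A : set R, measurable A ->
    distribution P Z (-%R @^-1` A) = distribution P Z A.
  move=> lawZ A mA; rewrite !lawZ ?normal_probN ?sqrtr_eq0 -?ltNge//.
  by rewrite -[X in measurable X]setTI; exact: oppr_measurable.
pose ZY : {mfun T >-> (R * (R * R))%type} :=
  HB.pack (fun w => (Y w, (u w, v w))) (isMeasurableFun.Build _ _ _ _ _ (pack Y)).
pose ZX : {mfun T >-> (R * (R * R))%type} :=
  HB.pack (fun w => (X w, (u w, v w))) (isMeasurableFun.Build _ _ _ _ _ (pack X)).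
pose fX (p : R * (R * (R * R))) := (sq_step p.1 p.2.1 p.2.2.1 p.2.2.2)%:E.
(* Here [p.1] is the value of [Y], and [p.2.1] that of [X], negated by the first flip. *)
pose fY (p : R * (R * (R * R))) := (sq_step (- p.2.1) p.1 p.2.2.1 p.2.2.2)%:E.
have m1 : measurable_fun setT (fun p : R * (R * (R * R)) => p.1).
  exact: measurable_fst.
have m22 : measurable_fun setT (fun p : R * (R * (R * R)) => p.2.2).
  exact: (measurableT_comp measurable_snd measurable_snd).
have m2 : measurable_fun setT (fun p : R * (R * (R * R)) => p.2.1).
  exact: (measurableT_comp measurable_fst measurable_snd).
have m3 : measurable_fun setT (fun p : R * (R * (R * R)) => p.2.2.1).
  exact: (measurableT_comp measurable_fst m22).
have m4 : measurable_fun setT (fun p : R * (R * (R * R)) => p.2.2.2).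
  exact: (measurableT_comp measurable_snd m22).
have mfX : measurable_fun setT fX by exact: measurable_sq_step.
have mfY : measurable_fun setT fY.
  by apply: measurable_sq_step => //; exact: measurable_funN.
have := ge0_integral_independentN (Z := ZY) indepX (lawN _ lawX) mfX
  (fun p => sq_step_ge0 _ _ _ _).
rewrite /fX /= => ->.
have := ge0_integral_independentN (Z := ZX) indepY (lawN _ lawY) mfY
  (fun p => sq_step_ge0 _ _ _ _).
by rewrite /fY /= => ->.
Qed.

(** Independence factors the integral, and each of the two exponentials contributes
    [expR (t ^+ 2 * h / 2)]. *)
Lemma integral_cosh_mul (Z Z' : {mfun T >-> R}) t :
  (forall B : set R, measurable B ->
    distribution P Z B = normal_prob 0 (Num.sqrt h) B) ->
  (forall (A : set R) (B : set (R * (R * R))),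
    measurable A -> measurable B ->
    (P (Z @^-1` A `&` (fun w => (Z' w, (u w, v w))) @^-1` B) =
     P (Z @^-1` A) * P ((fun w => (Z' w, (u w, v w))) @^-1` B))%E) ->
  (\int[P]_w ((expR (t * Z w) + expR (- t * Z w))%:E *
      (u w ^+ 2 + v w ^+ 2)%:E) =
   (2 * expR (t ^+ 2 * h / 2))%:E * \int[P]_w (u w ^+ 2 + v w ^+ 2)%:E)%E.
Proof.
move=> lawZ indepZ.
pose U : {mfun T >-> (R * (R * R))%type} :=
  HB.pack (fun w => (Z' w, (u w, v w))) (isMeasurableFun.Build _ _ _ _ _
    (measurable_fun_pair (measurable_funP Z') (measurable_fun_pair mu mv))).
have mexp (s : R) : measurable_fun setT (fun x : R => (expR (s * x))%:E).
  by apply/measurable_EFinP; apply: measurableT_comp => //; exact: measurable_funM.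
have mg : measurable_fun setT
    (fun p : R * (R * R) => (p.2.1 ^+ 2 + p.2.2 ^+ 2)%:E).
  apply/measurable_EFinP; apply: measurable_funD; apply: measurable_funX;
  exact: measurableT_comp.
have mf : measurable_fun setT (fun x : R => (expR (t * x) + expR (- t * x))%:E).
  by under eq_fun do rewrite EFinD; exact: emeasurable_funD.
have f0 (x : R) : (0 <= (expR (t * x) + expR (- t * x))%:E)%E.
  by rewrite lee_fin addr_ge0 ?expR_ge0.
have g0 (p : R * (R * R)) : (0 <= (p.2.1 ^+ 2 + p.2.2 ^+ 2)%:E)%E.
  by rewrite lee_fin addr_ge0 ?sqr_ge0.
rewrite [LHS](ge0_integral_independentM (X := Z) (Z := U) indepZ mf mg f0 g0).
congr (_ * _)%E.
rewrite (ge0_integral_distribution Z mf f0) (ge0_integral_normal_law lawZ mf f0).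
under eq_integral do rewrite EFinD.
have e0 a (x : R) : setT x -> (0 <= (expR (a * x))%:E)%E.
  by rewrite lee_fin expR_ge0.
rewrite ge0_integralD//; [|exact: mexp|exact: mexp].
rewrite !normal_prob_mgf ?sqrtr_eq0 -?ltNge//.
by rewrite -EFinD sqrrN sqr_sqrtr ?(ltW h0)//; congr EFin; ring.
Qed.

Lemma integral_sq_step_le :
  (\int[P]_w (sq_step (X w) (Y w) (u w) (v w))%:E <=
   (expR (2 * c + 2 * (sigma1 ^+ 2 + sigma2 ^+ 2) * h))%:E *
   \int[P]_w (u w ^+ 2 + v w ^+ 2)%:E)%E.
Proof.
set S := sigma1 ^+ 2 + sigma2 ^+ 2; set t := 2 * Num.sqrt S.
have S0 : 0 < S by rewrite ltr_pwDl ?sqr_ge0// exprn_even_gt0.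
set I := (\int[P]_w (sq_step _ _ _ _)%:E)%E.
set M := (\int[P]_w _)%E.
have mZ (Z : {mfun T >-> R}) : measurable_fun setT Z by exact: measurable_funP.
have mN (Z : {mfun T >-> R}) : measurable_fun setT (fun w => - Z w).
  exact: measurable_funN.
have mq : measurable_fun setT (fun w => (u w ^+ 2 + v w ^+ 2)%:E).
  by apply/measurable_EFinP; apply: measurable_funD; exact: measurable_funX.
pose k (s x : R) := expR (s * x) + expR (- s * x).
have mk (Z : {mfun T >-> R}) s : measurable_fun setT (fun w => (k s (Z w))%:E).
  apply/measurable_EFinP.
  by apply: measurable_funD; apply: measurableT_comp => //; exact: measurable_funM.
have k0 s x : 0 <= k s x by rewrite addr_ge0 ?expR_ge0.
have q0 w : (0 <= (u w ^+ 2 + v w ^+ 2)%:E)%E by rewrite lee_fin addr_ge0 ?sqr_ge0.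
(* Doubling makes room for the sum of the integrals at [(X, Y)] and [(- X, - Y)], to which
   [step_symmetrized] applies. *)
have -> : (I <= (expR (2 * c + 2 * S * h))%:E * M =
   (2%:E * I <= 2%:E * ((expR (2 * c + 2 * S * h))%:E * M)))%E.
  by rewrite lee_pmul2l.
have -> : (2%:E * I = \int[P]_w ((expR (2 * c) *
    (expR (2 * Num.sqrt ((sigma1 * X w) ^+ 2 + (sigma2 * Y w) ^+ 2)) +
     expR (- (2 * Num.sqrt ((sigma1 * X w) ^+ 2 + (sigma2 * Y w) ^+ 2)))) *
    (u w ^+ 2 + v w ^+ 2))%:E))%E.
  rewrite mule_natl mule2n {2}/I integral_sq_stepN -ge0_integralD//; first last.
  - exact: measurable_sq_step.
  - by move=> w _; exact: sq_step_ge0.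
  - exact: measurable_sq_step.
  - by move=> w _; exact: sq_step_ge0.
  by apply: eq_integral => w _; rewrite -EFinD -step_symmetrized /sq_step !mulrN.
have p0 (s : R) : 0 <= s ^+ 2 / S by rewrite divr_ge0 ?sqr_ge0// ltW.
pose p s := expR (2 * c) * (s ^+ 2 / S).
have p'0 s : 0 <= p s by rewrite mulr_ge0 ?expR_ge0.
(* The bound of [cosh_sum_le] separates [X] from [Y], so that each summand involves a single
   Gaussian variable independent of [(u, v)]. *)
apply: (@le_trans _ _ (\int[P]_w (
    (p sigma1)%:E * ((k t (X w))%:E * (u w ^+ 2 + v w ^+ 2)%:E) +
    (p sigma2)%:E * ((k t (Y w))%:E * (u w ^+ 2 + v w ^+ 2)%:E)))%E).
  apply: ge0_le_integral => //.
  - move=> w _; rewrite lee_fin; apply: mulr_ge0; last by rewrite addr_ge0 ?sqr_ge0.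
    by apply: mulr_ge0; rewrite ?addr_ge0 ?expR_ge0.
  - apply/measurable_EFinP; apply: measurable_funM; last exact/measurable_EFinP.
    have mr : measurable_fun setT (fun w =>
        Num.sqrt ((sigma1 * X w) ^+ 2 + (sigma2 * Y w) ^+ 2)).
      by apply: measurable_hypot; exact: measurable_funM.
    apply: measurable_funM => //; apply: measurable_funD.
      by apply: measurableT_comp => //; exact: measurable_funM.
    by apply: measurableT_comp => //; apply: measurable_funN; exact: measurable_funM.
  - by apply: emeasurable_funD; do 2 apply: emeasurable_funM => //.
  move=> w _; rewrite -!EFinM -EFinD lee_fin.
  rewrite [leRHS](_ : _ = expR (2 * c) * (sigma1 ^+ 2 / S * k t (X w) +
    sigma2 ^+ 2 / S * k t (Y w)) * (u w ^+ 2 + v w ^+ 2)); last by rewrite /p; ring.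
  rewrite ler_wpM2r ?addr_ge0 ?sqr_ge0// ler_pM2l ?expR_gt0//.
  exact: cosh_sum_le.
rewrite ge0_integralD//; first last.
- by do 2 apply: emeasurable_funM => //.
- by move=> w _; rewrite !mule_ge0// lee_fin.
- by do 2 apply: emeasurable_funM => //.
- by move=> w _; rewrite !mule_ge0// lee_fin.
rewrite !ge0_integralZl//; try by [move=> w _; rewrite mule_ge0// lee_fin|
  apply: emeasurable_funM].
rewrite (integral_cosh_mul _ lawX indepX) (integral_cosh_mul _ lawY indepY) -/M.
have M0 : (0 <= M)%E by apply: integral_ge0.
have pe s x : (0 <= (p s * (2 * expR x))%:E)%E.
  by rewrite lee_fin; apply: mulr_ge0 => //; rewrite mulr_ge0 ?expR_ge0.
(* Both summands carry the same Gaussian factor and the weights sum to [1]. *)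
rewrite !muleA -!EFinM -ge0_muleDl//.
rewrite -EFinD -mulrDl /p -mulrDr -mulrDl divff ?gt_eqF// mulr1.
rewrite (_ : t ^+ 2 * h / 2 = 2 * S * h); last first.
    by rewrite exprMn sqr_sqrtr ?(ltW S0)//; field.
  by rewrite mulrCA -expRD.
all: by rewrite lee_fin.
Qed.

End contraction.

(** * ** Mean-square decay along the scheme *)

Section magnus_euler_test.
Context (R : realType).
Variables (lambda sigma1 sigma2 h : R).

Let c := h * (lambda - (sigma1 ^+ 2 + sigma2 ^+ 2) / 2).
Let incr T (W : 'I_2 -> R -> T -> R) n j : T -> R :=
  W j (n.+1%:R * h) \- W j (n%:R * h).
Let method T := @magnus_euler R T 1 2 (test_drift lambda) (test_diffusion sigma1 sigma2).

Lemma magnus_euler_testS T (W : 'I_2 -> R -> T -> R) y0 n w :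
  let y := method W h y0 n w in
  let z := method W h y0 n.+1 w in
  let a := sigma1 * incr W n 0 w in
  let b := sigma2 * incr W n 1 w in
  z 0 0 = step0 c a b (y 0 0) (y 1 0) /\ z 1 0 = step1 c a b (y 0 0) (y 1 0).
Proof.
rewrite /method /= magnus_exponent_test.
exact: expmx_symm_mulE.
Qed.

Lemma random_vector2P d (T : measurableType d) (y : T -> 'cV[R]_2) :
  random_vector y <->
  measurable_fun setT (fun w => y w 0 0) /\ measurable_fun setT (fun w => y w 1 0).
Proof.
split => [my|[my0 my1] i]; first by split; exact: my.
case: i => [[|[|//]] i].
- by rewrite (_ : Ordinal _ = 0)//; exact/val_inj.
- by rewrite (_ : Ordinal _ = 1)//; exact/val_inj.
Qed.

(** Stated for any measurable structure on [T], hence also for the sigma-algebra generated by the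
    past; only increments over steps before [n] enter. *)
Lemma random_vector_magnus_euler d (T : measurableType d)
    (W : 'I_2 -> R -> T -> R) (y0 : T -> 'cV[R]_2) n :
  random_vector y0 ->
  (forall j k, (k < n)%N -> measurable_fun setT (incr W k j)) ->
  random_vector (method W h y0 n).
Proof.
move=> my0; elim: n => [//|n ih] mW.
have /random_vector2P[m0 m1] := ih (fun j k kn => mW j k (ltnW kn)).
have ma : measurable_fun setT (fun w => sigma1 * incr W n 0 w).
  by apply: measurable_funM => //; exact: mW.
have mb : measurable_fun setT (fun w => sigma2 * incr W n 1 w).
  by apply: measurable_funM => //; exact: mW.
apply/random_vector2P; split.
- under eq_fun do rewrite (magnus_euler_testS W y0 n _).1.
  exact: measurable_step0.
- under eq_fun do rewrite (magnus_euler_testS W y0 n _).2.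
  exact: measurable_step1.
Qed.

Lemma mean_square2E d (T : measurableType d) (P : probability T R)
    (y : T -> 'cV[R]_2) :
  mean_square P y = (\int[P]_w (y w 0%R 0%R ^+ 2 + y w 1%R 0%R ^+ 2)%:E)%E.
Proof.
rewrite /mean_square unlock; apply: eq_integral => w _; congr EFin.
rewrite !mxE !big_ord_recl big_ord0 !mxE addr0.
by have -> : lift ord0 ord0 = 1 :> 'I_2 by exact/val_inj.
Qed.

Context d (T : measurableType d) (P : probability T R) (F : R -> set_system T)
  (W : 'I_2 -> R -> T -> R) (y0 : T -> 'cV[R]_2).
Hypotheses (hW : standard_wiener_pair P F W) (h0 : 0 < h) (s1 : sigma1 != 0).
Hypotheses (my0 : random_vector y0) (y0W : independent_of_increments P W y0).

Let y n := method W h y0 n.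

Let time_ge0 n : 0 <= n%:R * h.
Proof. by rewrite mulr_ge0// ltW. Qed.

Let time_lt n : n%:R * h < n.+1%:R * h.
Proof. by rewrite ltr_pM2r// ltr_nat. Qed.

Let time_le m n : (m <= n)%N -> m%:R * h <= n%:R * h.
Proof. by move=> mn; rewrite ler_pM2r// ler_nat. Qed.

Let mincr n j : measurable_fun setT (incr W n j).
Proof. by apply: measurable_funB; exact: measurable_wiener hW _ _ _. Qed.

Lemma incr_law n j (B : set R) : measurable B ->
  pushforward P (incr W n j) B = normal_prob 0 (Num.sqrt h) B.
Proof.
move=> mB; have [_ wW _] := hW.
rewrite (wiener_increment_law (wW j) (time_ge0 n) (time_lt n) mB).
have -> : n.+1%:R * h - n%:R * h = h by rewrite -natr1; ring.
by [].
Qed.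

(** The state at step [n] and the simultaneous increment of [W j'] are both measurable for the
    sigma-algebra of [wiener_increment_past]. *)
Lemma incr_indep n j j' (A : set R) (B : set (R * (R * R))) : j != j' ->
  measurable A -> measurable B ->
  (P (incr W n j @^-1` A `&`
      (fun w => (incr W n j' w, (y n w 0%R 0%R, y n w 1%R 0%R))) @^-1` B) =
   P (incr W n j @^-1` A) *
   P ((fun w => (incr W n j' w, (y n w 0%R 0%R, y n w 1%R 0%R))) @^-1` B))%E.
Proof.
move=> jj' mA mB.
have [G [iG mG my0G mj mj']] :=
  wiener_increment_past hW my0 y0W jj' (time_ge0 n) (time_lt n).
have /random_vector2P[yG0 yG1] : @random_vector R _ (g_sigma_algebraType G) 2 (y n).
  apply: random_vector_magnus_euler => // i k kn.
  (* For [W j] only increments ending by the current time are available, and [k < n] ensures this;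
     the other index must be [j'], whose increments are all available. *)
  have [->|ij] := eqVneq i j.
    by apply: mj => //; exact: time_le (ltnW kn) || exact: time_le.
  have -> : i = j'.
    apply/val_inj; move: ij jj'; case: i => [[|[|//]] ?];
    by case: j {iG mj} => [[|[|//]] ?]; case: j' {mj'} => [[|[|//]] ?].
  exact: mj'.
apply: iG; first by exists A => //; rewrite setTI.
rewrite -[X in <<s _ >> X]setTI.
have mZ : measurable_fun setT
    (fun w : g_sigma_algebraType G => (incr W n j' w, (y n w 0%R 0%R, y n w 1%R 0%R))).
  apply: measurable_fun_pair; first exact: mj'.
  exact: measurable_fun_pair.
exact: mZ.
Qed.

Lemma mean_square_magnus_eulerS n :
  (mean_square P (y n.+1) <=
   (expR ((2 * lambda + sigma1 ^+ 2 + sigma2 ^+ 2) * h))%:E *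
   mean_square P (y n))%E.
Proof.
pose X : {mfun T >-> R} :=
  HB.pack (incr W n 0) (isMeasurableFun.Build _ _ _ _ _ (mincr n 0)).
pose Y : {mfun T >-> R} :=
  HB.pack (incr W n 1) (isMeasurableFun.Build _ _ _ _ _ (mincr n 1)).
have /random_vector2P[mu mv] : random_vector (y n).
  by apply: random_vector_magnus_euler.
have := @integral_sq_step_le _ _ _ P c h sigma1 sigma2 X Y
  (fun w => y n w 0 0) (fun w => y n w 1 0) h0 s1 mu mv
  (@incr_law n 0) (@incr_law n 1)
  (fun A B => @incr_indep n 0 1 A B isT) (fun A B => @incr_indep n 1 0 A B isT).
rewrite !mean_square2E; congr (_ <= (expR _)%:E * _)%E.
- apply: eq_integral => w _; congr EFin.
  by have [-> ->] := magnus_euler_testS W y0 n w.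
(* The correction in the exponent contributes [- (sigma1 ^+ 2 + sigma2 ^+ 2) * h] to [2 * c], which
   offsets half of the noise growth. *)
- by rewrite /c; field.
Qed.

Lemma mean_square_magnus_euler_le n :
  (mean_square P (y n) <=
   (expR ((2 * lambda + sigma1 ^+ 2 + sigma2 ^+ 2) * h) ^+ n)%:E *
   mean_square P y0)%E.
Proof.
elim: n => [|n ih]; first by rewrite expr0 mul1e.
apply: (le_trans (mean_square_magnus_eulerS n)).
set rho := expR _; by rewrite (exprS rho) EFinM -muleA lee_wpmul2l// lee_fin expR_ge0.
Qed.

End magnus_euler_test.

Theorem theorem3p3 (R : realType) (d : measure_display) (T : measurableType d)
    (P : probability T R) (F : R -> set_system T) (W : 'I_2 -> R -> T -> R)
    (hW : standard_wiener_pair P F W) :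
  mean_square_A_stable P W (@magnus_euler R T 1 2).
Proof.
move=> lambda sigma1 sigma2 _ s1 _ stable h h0 y0 my0 y0W y0_fin.
have ge0 (y : T -> 'cV[R]_2) : (0 <= mean_square P y)%E.
  by rewrite mean_square2E; apply: integral_ge0 => w _; rewrite lee_fin addr_ge0 ?sqr_ge0.
set rho := expR ((2 * lambda + sigma1 ^+ 2 + sigma2 ^+ 2) * h).
have rho0 : 0 <= rho by exact: expR_ge0.
have rho1 : rho < 1 by rewrite expR_lt1 nmulr_rlt0.
(* Squeeze between [0] and a geometric sequence of ratio [rho < 1]; finiteness of the initial mean
   square lets the limit pass through the product. *)
apply: (@squeeze_cvge _ _ _ _ (cst 0%E) _
  (fun n => (rho ^+ n)%:E * mean_square P y0)%E).
- apply: nearW => n; rewrite ge0/=.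
  exact: mean_square_magnus_euler_le hW h0 s1 my0 y0W n.
- exact: cvg_cst.
- rewrite -(mul0e (mean_square P y0)).
  apply: cvgeZr; first by rewrite ge0_fin_numE.
  apply: cvg_EFin; first exact: nearW.
  by apply: cvg_expr; rewrite ger0_norm.
Qed.
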